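(* Let $f \colon M \to N$ be a continuous map between manifolds and let $x \in M$. (1) The map $f$ is Lipschitz on a neighborhood of $x$ if and only if $C_x^0(f) = \{0\}$. (2) The map $f$ is strictly differentiable at $x$ if and only if $C_x^0(f) = \{0\}$ and $C_x(f)$ is contained in a $(\dim_x M)$-dimensional vector subspace of $T_{(x,f(x))}(M\times N)$, and in that case, $C_x(f) = \Gamma_{T_xf}$, the graph of the derivative of $f$ at $x$.
   Context: Manifolds are real, finite-dimensional, smooth ($C^\infty$), paracompact and Hausdorff. Whitney cone: for subsets $A,B$ of a manifold $P$ and $p\in P$, $C_p(A,B)$ is the set of $u \in T_pP$ for which there are sequences $x_n \in A$, $y_n \in B$, $c_n \in \mathbb{R}_{>0}$ with $x_n \to p$, $y_n \to p$ and $c_n(y_n - x_n) \to u$ (computed in a chart at $p$; independent of the chart). With $\Gamma_f$ the graph of $f$, set $C_x(f) = C_{(x,f(x))}(\Gamma_f,\Gamma_f) \subseteq T_xM \times T_{f(x)}N$ and $C_x^0(f) = C_x(f) \cap (\{0\} \times T_{f(x)}N)$. Lipschitz: a continuous map between manifolds is Lipschitz at $x_0$ if there are charts at $x_0$ and $f(x_0)$ and $C \in \mathbb{R}$ such that in these charts, for every $\epsilon>0$, $f$ is $(C+\epsilon)$-Lipschitz on some neighborhood of $x_0$; it is Lipschitz (on an open set) if it is so at each point. Strict differentiability: $f$ is strictly differentiable at $x$ if there exist a linear map $L \colon T_xM \to T_{f(x)}N$ and charts at $x$ and $f(x)$ such that, in these charts, for every $\epsilon>0$ there is a neighborhood of $x$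 on which $f-L$ is $\epsilon$-Lipschitz; then $T_xf = L$. *)

(* Defs.v *)
From HB Require Import structures.
From mathcomp Require Import all_boot all_order all_algebra.
From mathcomp Require Import all_classical all_reals all_analysis.

Set Implicit Arguments.
Unset Strict Implicit.
Unset Printing Implicit Defensive.

Import Order.TTheory GRing.Theory Num.Theory.
Import numFieldNormedType.Exports.

Local Open Scope classical_set_scope.
Local Open Scope ring_scope.

(* For U open, C^{k+1} on U: differentiable at each point of U, with all
   directional derivatives of class C^k on U. *)
Fixpoint Ck_on (R : realType) (V W : normedModType R) (k : nat)
    (U : set V) (f : V -> W) : Prop :=
  match k with
  | 0%N => forall x, U x -> {for x, continuous f}
  | k'.+1 => (forall x, U x -> differentiable f x) /\
             (forall v, Ck_on k' U ('D_v f))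
  end.

Definition smooth_on (R : realType) (V W : normedModType R)
    (U : set V) (f : V -> W) : Prop := forall k, Ck_on k U f.

(* The values of cmap outside csrc, and of cinv outside the image of csrc,
   are irrelevant. *)
Record chart (R : realType) (T : topologicalType) := Chart {
  cdim : nat ;
  csrc : set T ;
  cmap : T -> 'rV[R]_cdim ;
  cinv : 'rV[R]_cdim -> T ;
  csrc_open : open csrc ;
  cimg_open : open (cmap @` csrc) ;
  cmapK : forall x, csrc x -> cinv (cmap x) = x ;
  cmap_cont : forall x, csrc x -> {for x, continuous cmap} ;
  cinv_cont : forall a, (cmap @` csrc) a -> {for a, continuous cinv} }.

Arguments cdim {R T} c.
Arguments csrc {R T} c.
Arguments cmap {R T} c.
Arguments cinv {R T} c.

Definition transition (R : realType) (T : topologicalType)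
    (phi psi : chart R T) : 'rV[R]_(cdim phi) -> 'rV[R]_(cdim psi) :=
  fun a => cmap psi (cinv phi a).
Arguments transition {R T} phi psi.

Definition smooth_transition (R : realType) (T : topologicalType)
    (phi psi : chart R T) : Prop :=
  smooth_on (cmap phi @` (csrc phi `&` csrc psi)) (transition phi psi).

(* A smooth atlas, with a distinguished chart around every point: tangent
   vectors at x are represented by their coordinates in chart_at x. The charts
   may have different dimensions. *)
Record smooth_space (R : realType) := SmoothSpace {
  carrier :> topologicalType ;
  atlas : set (chart R carrier) ;
  atlas_smooth : forall phi psi, atlas phi -> atlas psi ->
    smooth_transition phi psi ;
  chart_at : carrier -> chart R carrier ;
  chart_at_atlas : forall x, atlas (chart_at x) ;
  mem_chart_at : forall x, csrc (chart_at x) x }.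
Arguments atlas {R} s.
Arguments chart_at {R} s x.

Definition locally_finite (T : topologicalType) (D : set (set T)) : Prop :=
  forall x : T, exists2 A, nbhs x A &
    finite_set [set V | D V /\ V `&` A !=set0].

Definition open_cover (T : topologicalType) (C : set (set T)) : Prop :=
  (forall U, C U -> open U) /\ \bigcup_(U in C) U = setT.

Definition paracompact (T : topologicalType) : Prop :=
  forall C : set (set T), open_cover C ->
  exists D : set (set T), [/\ open_cover D,
    (forall V, D V -> exists2 U, C U & V `<=` U) & locally_finite D].

Record manifold (R : realType) := Manifold {
  manifold_space :> smooth_space R ;
  manifold_hausdorff : hausdorff_space manifold_space ;
  manifold_paracompact : paracompact manifold_space }.

Definition dim_at (R : realType) (M : smooth_space R) (x : M) : nat :=
  cdim (chart_at M x).

Definition tangent (R : realType) (M : smooth_space R) (x : M) : Type :=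
  'rV[R]_(dim_at x).
Arguments tangent {R} M x.

(* phi is a chart at x of the maximal atlas generated by atlas M. *)
Definition is_chart_at (R : realType) (M : smooth_space R) (x : M)
    (phi : chart R M) : Prop :=
  csrc phi x /\ forall psi, atlas M psi ->
    smooth_transition phi psi /\ smooth_transition psi phi.

(* The differential at x of a chart phi at x: it sends a tangent vector at x to
   its coordinates in phi. *)
Definition chart_diff (R : realType) (M : smooth_space R) (x : M)
    (phi : chart R M) : tangent M x -> 'rV[R]_(cdim phi) :=
  'd (transition (chart_at M x) phi) (cmap (chart_at M x) x).
Arguments chart_diff {R M x} phi.

Section ProductChart.
Variables (R : realType).

Lemma near_eq_differentiable (V W : normedModType R) (f g : V -> W) (x : V) :
  {near x, f =1 g} -> differentiable f x -> differentiable g x.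
Proof.
move=> fg df.
have -> : g = f + (g - f) by apply/funext => y; rewrite !fctE addrC subrK.
apply: differentiableD => //.
have h0 : (g - f) \o shift x =
    cst ((g - f) x) + (\0%R : {linear V -> W}) +o_ 0 id.
  apply/eqaddoP => _/posnumP[e].
  have -> : cst ((g - f) x) = 0 :> (V -> W).
    by rewrite funeqE => y; rewrite !fctE (nbhs_singleton fg) subrr.
  have shx : y + x @[y --> (0 : V)] --> x.
    by rewrite -{2}[x]add0r; apply: cvgD; [exact: cvg_id | exact: cvg_cst].
  have := shx _ fg; rewrite !nbhs_simpl /=.
  apply: filterS => y /= fgy.
  by rewrite !fctE /= fgy subrr addr0 subr0 normr0 mulr_ge0.
have c0 : continuous (\0%R : {linear V -> W}).
  by move=> y; exact: cst_continuous.
by apply/diff_locallyP; rewrite (diff_unique c0 h0).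
Qed.

Lemma Ck_on_eq (V W : normedModType R) k (U : set V) (f g : V -> W) :
  open U -> (forall x, U x -> f x = g x) -> Ck_on k U f -> Ck_on k U g.
Proof.
move=> oU; elim: k f g => [|k IH] f g fg /=.
  move=> cf x Ux; have nfg : {near x, f =1 g}.
    by move: (open_nbhs_nbhs (conj oU Ux)); apply: filterS.
  change (g y @[y --> x] --> g x); rewrite -(fg _ Ux).
  exact: cvg_trans (near_eq_cvg nfg) (cf x Ux).
move=> [df Df]; split=> [x Ux|v].
  apply: near_eq_differentiable (df x Ux).
  by move: (open_nbhs_nbhs (conj oU Ux)); apply: filterS.
apply: IH (Df v) => x Ux; apply: near_eq_derive.
by move: (open_nbhs_nbhs (conj oU Ux)); apply: filterS.
Qed.

Lemma row_mx_continuous m n : continuous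
  (fun p : 'rV[R]_m * 'rV[R]_n => row_mx p.1 p.2).
Proof.
move=> [u v]; apply/cvg_ballP => e e0; have := nbhsx_ballx (u, v) e e0.
apply: filterS => -[u' v'] [/= [_ uu'] [_ vv']]; split=> // i j.
by rewrite !mxE; case: splitP => l _; [exact: uu' | exact: vv'].
Qed.

Lemma continuous_row_mx (T : topologicalType) m n (f : T -> 'rV[R]_m)
    (g : T -> 'rV[R]_n) (x : T) :
  {for x, continuous f} -> {for x, continuous g} ->
  {for x, continuous (fun y => row_mx (f y) (g y))}.
Proof.
move=> cf cg; apply: (cvg_comp (fun y => (f y, g y))
  (fun p : 'rV[R]_m * 'rV[R]_n => row_mx p.1 p.2)).
  exact: (cvg_pair cf cg).
exact: (@row_mx_continuous m n (f x, g x)).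
Qed.

Lemma is_diff_row_mx (V : normedModType R) m n (f df : V -> 'rV[R]_m)
    (g dg : V -> 'rV[R]_n) (x : V) :
  is_diff x f df -> is_diff x g dg ->
  is_diff x (fun y => row_mx (f y) (g y)) (fun y => row_mx (df y) (dg y)).
Proof.
move=> Df Dg.
have linl : linear (fun u : 'rV[R]_m => row_mx u (0 : 'rV[R]_n)).
  by move=> a u v; rewrite scale_row_mx add_row_mx scaler0 addr0.
have linr : linear (fun v : 'rV[R]_n => row_mx (0 : 'rV[R]_m) v).
  by move=> a u v; rewrite scale_row_mx add_row_mx scaler0 addr0.
pose L : {linear _ -> _} := HB.pack
  (fun u : 'rV[R]_m => row_mx u (0 : 'rV[R]_n))
  (GRing.isLinear.Build _ _ _ _ _ linl).
pose M : {linear _ -> _} := HB.pack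
  (fun v : 'rV[R]_n => row_mx (0 : 'rV[R]_m) v)
  (GRing.isLinear.Build _ _ _ _ _ linr).
have cL : continuous L.
  by move=> u; apply: (@continuous_row_mx _ _ _ idfun (cst 0)) => //;
    exact: cst_continuous.
have cM : continuous M.
  by move=> u; apply: (@continuous_row_mx _ _ _ (cst 0) idfun) => //;
    exact: cst_continuous.
have DL : is_diff (f x) L L.
  by apply: DiffDef; [exact: linear_differentiable | exact: diff_lin].
have DM : is_diff (g x) M M.
  by apply: DiffDef; [exact: linear_differentiable | exact: diff_lin].
have -> : (fun y => row_mx (f y) (g y)) = (L \o f) + (M \o g).
  by apply/funext => y; rewrite !fctE /= add_row_mx addr0 add0r.
have -> : (fun y => row_mx (df y) (dg y)) = (L \o df) + (M \o dg).
  by apply/funext => y; rewrite !fctE /= add_row_mx addr0 add0r.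
exact: is_diffD.
Qed.

Definition prod_rv m n m' n' (f : 'rV[R]_m -> 'rV[R]_m')
    (g : 'rV[R]_n -> 'rV[R]_n') (a : 'rV[R]_(m + n)) : 'rV[R]_(m' + n') :=
  row_mx (f (lsubmx a)) (g (rsubmx a)).

Lemma Ck_on_prod k m n m' n' (U : set 'rV[R]_m) (V : set 'rV[R]_n)
    (W : set 'rV[R]_(m + n))
    (f : 'rV[R]_m -> 'rV[R]_m') (g : 'rV[R]_n -> 'rV[R]_n') :
  open W -> (forall a, W a -> U (lsubmx a) /\ V (rsubmx a)) ->
  Ck_on k U f -> Ck_on k V g -> Ck_on k W (prod_rv f g).
Proof.
move=> oW WUV; elim: k f g => [|k IH] f g /=.
  move=> cf cg a /WUV[Ua Va]; apply: continuous_row_mx.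
    by apply: continuous_comp; [exact: continuous_lsubmx | exact: cf].
  by apply: continuous_comp; [exact: continuous_rsubmx | exact: cg].
move=> [df Df] [dg Dg].
have dfg a : W a -> is_diff a (prod_rv f g) (fun v =>
    row_mx ('d f (lsubmx a) (lsubmx v)) ('d g (rsubmx a) (rsubmx v))).
  move=> /WUV[Ua Va]; apply: is_diff_row_mx.
    apply: (is_diff_comp (f := lsubmx)); last exact/differentiableP/df.
    by apply: DiffDef; [exact: differentiable_lsubmx
      | exact/diff_lin/continuous_lsubmx].
  apply: (is_diff_comp (f := rsubmx)); last exact/differentiableP/dg.
  by apply: DiffDef; [exact: differentiable_rsubmx
    | exact/diff_lin/continuous_rsubmx].
split=> [a /dfg[]//|v].
apply: (Ck_on_eq oW (f := prod_rv ('D_(lsubmx v) f) ('D_(rsubmx v) g))).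
  move=> a Wa; have [Ua Va] := WUV a Wa; have [dpa dpE] := dfg a Wa.
  by rewrite /prod_rv !deriveE //; [rewrite dpE | exact: dg | exact: df].
exact: IH.
Qed.

End ProductChart.

Section ProductSpace.
Variables (R : realType).

Section Chart.
Variables (T S : topologicalType) (phi : chart R T) (psi : chart R S).

Let src : set (T * S) := csrc phi `*` csrc psi.

Definition prod_cmap (p : T * S) : 'rV[R]_(cdim phi + cdim psi) :=
  row_mx (cmap phi p.1) (cmap psi p.2).

Definition prod_cinv (a : 'rV[R]_(cdim phi + cdim psi)) : T * S :=
  (cinv phi (lsubmx a), cinv psi (rsubmx a)).

Lemma prod_cimgE (A : set T) (B : set S) :
  prod_cmap @` (A `*` B) =
  lsubmx @^-1` (cmap phi @` A) `&` rsubmx @^-1` (cmap psi @` B).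
Proof.
apply/seteqP; split => [_ [[x y] [/= Ax By] <-]|a [[x Ax xa] [y By ya]]].
  by rewrite /prod_cmap /= row_mxKl row_mxKr; split; [exists x | exists y].
by exists (x, y) => //; rewrite /prod_cmap /= xa ya hsubmxK.
Qed.

Lemma prod_open_cimg (A : set T) (B : set S) :
  open (cmap phi @` A) -> open (cmap psi @` B) -> open (prod_cmap @` (A `*` B)).
Proof.
move=> oA oB; rewrite prod_cimgE; apply: openI.
  by apply: open_comp oA => a _; exact: continuous_lsubmx.
by apply: open_comp oB => a _; exact: continuous_rsubmx.
Qed.

Lemma prod_csrc_open : open src.
Proof.
have -> : src = fst @^-1` csrc phi `&` snd @^-1` csrc psi by [].
apply: openI; apply: open_comp (csrc_open _) => p _;
  [exact: cvg_fst | exact: cvg_snd].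
Qed.

Lemma prod_cimg_open : open (prod_cmap @` src).
Proof. by apply: prod_open_cimg; exact: cimg_open. Qed.

Lemma prod_cmapK p : src p -> prod_cinv (prod_cmap p) = p.
Proof.
by case: p => x y [/= sx sy]; rewrite /prod_cinv row_mxKl row_mxKr !cmapK.
Qed.

Lemma prod_cmap_cont p : src p -> {for p, continuous prod_cmap}.
Proof.
case: p => x y [/= sx sy]; apply: continuous_row_mx.
  by apply: (@continuous_comp _ _ _ fst (cmap phi));
    [exact: cvg_fst | exact: cmap_cont].
by apply: (@continuous_comp _ _ _ snd (cmap psi));
  [exact: cvg_snd | exact: cmap_cont].
Qed.

Lemma prod_cinv_cont a : (prod_cmap @` src) a -> {for a, continuous prod_cinv}.
Proof.
rewrite prod_cimgE => -[sx sy].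
have cl : {for a, continuous (cinv phi \o lsubmx)}.
  by apply: continuous_comp; [exact: continuous_lsubmx | exact: cinv_cont].
have cr : {for a, continuous (cinv psi \o rsubmx)}.
  by apply: continuous_comp; [exact: continuous_rsubmx | exact: cinv_cont].
exact: (cvg_pair cl cr).
Qed.

Definition prod_chart : chart R (T * S)%type :=
  Chart prod_csrc_open prod_cimg_open prod_cmapK prod_cmap_cont prod_cinv_cont.

End Chart.

Lemma open_cmap_image (T : topologicalType) (phi : chart R T) (A : set T) :
  open A -> open (cmap phi @` (csrc phi `&` A)).
Proof.
move=> oA.
have -> : cmap phi @` (csrc phi `&` A) =
    cmap phi @` csrc phi `&` cinv phi @^-1` A.
  apply/seteqP; split => [_ [x [sx Ax] <-]|_ [[x sx <-]]] /=.
    by split; [exists x | rewrite cmapK].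
  by rewrite cmapK // => Ax; exists x.
rewrite openE => _ [[x sx <-]] /= Ax.
have imx : (cmap phi @` csrc phi) (cmap phi x) by exists x.
have n1 : nbhs (cmap phi x) (cmap phi @` csrc phi).
  by apply: open_nbhs_nbhs; split=> //; exact: cimg_open.
have n2 : nbhs (cmap phi x) (cinv phi @^-1` A).
  by apply: (cinv_cont imx); apply: open_nbhs_nbhs.
exact: filterI n1 n2.
Qed.

Lemma prod_smooth_transition (T S : topologicalType)
    (phi phi' : chart R T) (psi psi' : chart R S) :
  smooth_transition phi phi' -> smooth_transition psi psi' ->
  smooth_transition (prod_chart phi psi) (prod_chart phi' psi').
Proof.
move=> sphi spsi k; rewrite /=.
have setE : (csrc phi `*` csrc psi) `&` (csrc phi' `*` csrc psi') =
    (csrc phi `&` csrc phi') `*` (csrc psi `&` csrc psi').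
  by rewrite -setXI.
rewrite setE.
apply: (Ck_on_prod _ _ (sphi k) (spsi k)).
  by apply: prod_open_cimg; apply: open_cmap_image; exact: csrc_open.
by move=> a; rewrite prod_cimgE.
Qed.

Variables (M N : smooth_space R).

Definition prod_atlas : set (chart R (M * N)%type) :=
  [set c | exists phi psi,
    [/\ atlas M phi, atlas N psi & c = prod_chart phi psi]].

Lemma prod_atlas_smooth c c' : prod_atlas c -> prod_atlas c' ->
  smooth_transition c c'.
Proof.
move=> [phi [psi [aphi apsi ->]]] [phi' [psi' [aphi' apsi' ->]]].
by apply: prod_smooth_transition; exact: atlas_smooth.
Qed.

Definition prod_chart_at (p : M * N) : chart R (M * N)%type :=
  prod_chart (chart_at M p.1) (chart_at N p.2).

Lemma prod_chart_at_atlas p : prod_atlas (prod_chart_at p).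
Proof.
by exists (chart_at M p.1), (chart_at N p.2); split=> //; exact: chart_at_atlas.
Qed.

Lemma prod_mem_chart_at p : csrc (prod_chart_at p) p.
Proof. by split; exact: mem_chart_at. Qed.

(* The distinguished chart at (x, y) is the product of those at x and y, so
   that T_(x, y) (M * N) is T_x M * T_y N, the pair (u, v) being row_mx u v. *)
Definition prod_space : smooth_space R :=
  SmoothSpace prod_atlas_smooth prod_chart_at_atlas prod_mem_chart_at.

End ProductSpace.

Section WhitneyCone.
Variables (R : realType).

(* Computed in the chart at p that also gives the coordinates of the tangent
   vectors at p. *)
Definition whitney_cone (P : smooth_space R) (p : P) (A B : set P) :
    set (tangent P p) :=
  [set u : tangent P p | exists (x y : nat -> P) (c : nat -> R),
    [/\ forall n, [/\ A (x n), B (y n) & 0 < c n],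
        x n @[n --> \oo] --> p, y n @[n --> \oo] --> p &
        c n *: (cmap (chart_at P p) (y n) - cmap (chart_at P p) (x n))
          @[n --> \oo] --> u]].
Arguments whitney_cone P p A B : clear implicits.

Variables (M N : smooth_space R) (f : M -> N).

Definition fgraph : set (prod_space M N) := [set p | p.2 = f p.1].

Definition fcone (x : M) : set (tangent (prod_space M N) (x, f x)) :=
  whitney_cone (prod_space M N) (x, f x) fgraph fgraph.
Arguments fcone x : clear implicits.

Definition fcone0 (x : M) : set (tangent (prod_space M N) (x, f x)) :=
  fcone x `&`
  [set row_mx (0 : tangent M x) v | v in [set: tangent N (f x)]].
Arguments fcone0 x : clear implicits.

Definition local_rep (phi : chart R M) (psi : chart R N) :
    'rV[R]_(cdim phi) -> 'rV[R]_(cdim psi) :=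
  fun a => cmap psi (f (cinv phi a)).
Arguments local_rep phi psi : clear implicits.

(* U is a neighborhood of phi(x) on which the local representative of f is
   defined. *)
Definition local_nbhs (phi : chart R M) (psi : chart R N) (x : M)
    (U : set 'rV[R]_(cdim phi)) : Prop :=
  nbhs (cmap phi x) U /\ U `<=` cmap phi @` (csrc phi `&` f @^-1` csrc psi).
Arguments local_nbhs phi psi x U : clear implicits.

(* 'rV[R]_n carries the sup norm; another norm would only change C. *)
Definition lipschitz_at (x : M) : Prop :=
  exists (phi : chart R M) (psi : chart R N) (C : R),
    [/\ is_chart_at x phi, is_chart_at (f x) psi &
      forall e : R, 0 < e -> exists U, local_nbhs phi psi x U /\
        (C + e).-lipschitz_U (local_rep phi psi)].

Definition lipschitz_on_open (U : set M) : Prop :=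
  open U /\ forall y, U y -> lipschitz_at y.

(* L is T_x f; Lc is the expression of L in the charts phi and psi. *)
Definition strict_derivative (x : M)
    (L : {linear tangent M x -> tangent N (f x)}) : Prop :=
  exists (phi : chart R M) (psi : chart R N)
      (Lc : {linear 'rV[R]_(cdim phi) -> 'rV[R]_(cdim psi)}),
    [/\ is_chart_at x phi, is_chart_at (f x) psi,
      forall u : tangent M x, Lc (chart_diff phi u) = chart_diff psi (L u) &
      forall e : R, 0 < e -> exists U, local_nbhs phi psi x U /\
        e.-lipschitz_U (fun a => local_rep phi psi a - Lc a)].
Arguments strict_derivative x L : clear implicits.

Definition strictly_differentiable (x : M) : Prop :=
  exists L : {linear tangent M x -> tangent N (f x)},
    strict_derivative x L.

(* The graph of L, as a subset of T_(x, f x) (M * N). *)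
Definition linear_graph (x : M) (L : {linear tangent M x -> tangent N (f x)}) :
    set (tangent (prod_space M N) (x, f x)) :=
  [set row_mx u (L u) | u in [set: tangent M x]].

End WhitneyCone.

Arguments fcone {R M N} f x.
Arguments fcone0 {R M N} f x.
Arguments lipschitz_at {R M N} f x.
Arguments lipschitz_on_open {R M N} f U.
Arguments strict_derivative {R M N} f x L.
Arguments strictly_differentiable {R M N} f x.
Arguments linear_graph {R M N} f x L.

(* Main.v *)
Require Import Defs.
From HB Require Import structures.
From mathcomp Require Import all_boot all_order all_algebra.
From mathcomp Require Import all_classical all_reals all_analysis.
From mathcomp Require Import ring lra.

Import Order.TTheory GRing.Theory Num.Theory.
Import numFieldNormedType.Exports.

Local Open Scope classical_set_scope.
Local Open Scope ring_scope.

Set Implicit Arguments.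
Unset Strict Implicit.
Unset Printing Implicit Defensive.

(** All statements are read in the distinguished charts at x and f x, where f
becomes a map F between spaces of row vectors and a is the point of x.  There
the Whitney cone of the graph of f with itself is the set of limits of secants
c (G q - G p) of the graph map G p = (p, F p), with c > 0 and p, q tending to
a ([fcone_secant]).  The proposition then splits into statements about F.

A K-Lipschitz F has all its secants in the closed cone |v| <= K |u|, so only
the zero vector is a limit of secants with first component 0.  Conversely, if
F is Lipschitz on no neighborhood of a, some secants have second component of
norm 1 and arbitrarily small first component; a cluster point of these is a
nonzero limit vector (0, v) ([cone0_trivial_lip]).

If F is strictly differentiable with derivative L then, for every e > 0, the
secants close enough to a lie in the closed cone |v - L u| <= e |u|; so the
limits are vectors (u, L u), and each of these is reached by secants issued
from a ([strict_diff_cone]).  Conversely, suppose that the cone is trivial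
over 0 and is contained in a subspace W of dimension dim_x M.  As F is
Lipschitz near a, its difference quotients in any direction u are bounded,
hence the cone contains a vector over u ([lip_cone_total]); so W projects onto
T_x M, and, the dimensions being equal, W is the graph of a linear map L
([vspace_graph]).  If F - L were e-Lipschitz on no neighborhood of a, for some
e > 0, then secants (u, v) with |u| = 1 and |v - L u| >= e would accumulate at
a vector of the cone outside of W ([graph_cone_strict]).

The three accumulation points used here come from one compactness argument,
[secant_cone_meet].

The definitions of Lipschitz and strictly differentiable maps allow arbitrary
charts, whereas the cone lives in the distinguished ones.  To pass from ones to
the others one needs that a transition map is strictly differentiable: by the
mean value inequality this is so for every map of class C^1
([C1_strict_diff]). *)

(** * Row vectors and linear maps *)

Section RowVectorNorm.
Context {R : realType}.

Lemma coord_le_norm n (u : 'rV[R]_n) i : `|u ord0 i| <= `|u|.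
Proof.
rewrite [leRHS]/Num.Def.normr /= mx_normrE.
exact: (le_bigmax _ (fun ij : 'I_1 * 'I_n => `|u ij.1 ij.2|) (ord0, i)).
Qed.

Lemma norm_le_coord n (u : 'rV[R]_n) k :
  0 <= k -> (forall i, `|u ord0 i| <= k) -> `|u| <= k.
Proof.
move=> k0 uk; rewrite [leLHS]/Num.Def.normr /= mx_normrE.
by apply: bigmax_le => // -[i j] _ /=; rewrite ord1.
Qed.

Lemma norm_row_mx_le m n (u : 'rV[R]_m) (v : 'rV[R]_n) k :
  `|u| <= k -> `|v| <= k -> `|row_mx u v| <= k.
Proof.
move=> uk vk; apply: norm_le_coord => [|i]; first exact: le_trans uk.
by rewrite mxE; case: splitP => j _; apply: le_trans (coord_le_norm _ _) _.
Qed.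

Lemma linear_rV_sum n (W : normedModType R) (L : {linear 'rV[R]_n -> W}) u :
  L u = \sum_i u ord0 i *: L (delta_mx ord0 i).
Proof.
rewrite {1}(row_sum_delta u) linear_sum.
by apply: eq_bigr => i _; rewrite linearZ.
Qed.

(** Two linear maps are compared on the canonical basis: this reduces the
continuity of a derivative to that of finitely many partial derivatives. *)
Lemma linear_sub_bound n (W : normedModType R) (L L' : {linear 'rV[R]_n -> W})
    k u : (forall j, `|L (delta_mx ord0 j) - L' (delta_mx ord0 j)| <= k) ->
  `|L u - L' u| <= k *+ n * `|u|.
Proof.
move=> LL'k; rewrite (linear_rV_sum L) (linear_rV_sum L') -sumrB.
apply: le_trans (ler_norm_sum _ _ _) _.
apply: (@le_trans _ _ (\sum_(j < n) k * `|u|)).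
  apply: ler_sum => j _; rewrite -scalerBr normrZ mulrC.
  by rewrite ler_pM ?coord_le_norm.
by rewrite sumr_const card_ord mulrnAl.
Qed.

Lemma linear_rV_bound n (W : normedModType R) (L : {linear 'rV[R]_n -> W}) :
  exists2 K, 0 < K & forall u, `|L u| <= K * `|u|.
Proof.
exists (1 + \sum_i `|L (delta_mx ord0 i)|).
  by rewrite ltr_pwDl // sumr_ge0.
move=> u; rewrite linear_rV_sum.
apply: le_trans (ler_norm_sum _ _ _) _.
rewrite mulrDl mul1r ler_wpDl // mulr_suml ler_sum // => i _.
by rewrite normrZ mulrC ler_wpM2l // coord_le_norm.
Qed.

Lemma linear_rV_continuous n (W : normedModType R)
    (L : {linear 'rV[R]_n -> W}) : continuous L.
Proof.
apply/linear_bounded_continuous/linear_boundedP.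
have [K K0 LK] := linear_rV_bound L.
by near=> r => u; apply: le_trans (LK u) _; rewrite ler_wpM2r.
Unshelve. all: by end_near. Qed.

End RowVectorNorm.

(** * Lipschitz and strictly differentiable maps *)

Lemma subrACA (V : zmodType) (a b c d : V) :
  a - b - (c - d) = (a - c) - (b - d).
Proof. by rewrite !opprD !opprK addrACA. Qed.

Section LipschitzStrict.
Context {R : realType}.

Definition lip_near (V W : normedModType R) (k : R) (F : V -> W) (a : V) :=
  exists2 U, nbhs a U &
    forall p q, U p -> U q -> `|F p - F q| <= k * `|p - q|.

(** L is a bare function so that the composite derivatives given by the chain
rule can be rewritten by extensionality. *)
Definition strict_diff (V W : normedModType R) (F : V -> W) (a : V)
    (L : V -> W) :=
  forall e : R, 0 < e -> lip_near e (fun p => F p - L p) a.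

Lemma lip_near_eq (V W : normedModType R) k (F G : V -> W) a :
  {near a, F =1 G} -> lip_near k F a -> lip_near k G a.
Proof.
move=> FG [U aU Uk]; exists (U `&` [set p | F p = G p]).
  exact: filterI.
by move=> p q [Up <-] [Uq <-]; exact: Uk.
Qed.

Lemma strict_diff_eq (V W : normedModType R) (F G : V -> W) a L :
  {near a, F =1 G} -> strict_diff F a L -> strict_diff G a L.
Proof.
move=> FG sF e e0; apply: lip_near_eq (sF e e0).
by apply: filterS FG => p ->.
Qed.

Lemma lip_near_comp (V W X : normedModType R) k l (F : V -> W) (G : W -> X) a :
  0 <= l -> {for a, continuous F} ->
  lip_near k F a -> lip_near l G (F a) -> lip_near (l * k) (G \o F) a.
Proof.
move=> l0 cF [U aU Uk] [U' aU' Ul]; exists (U `&` F @^-1` U').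
  by apply: filterI => //; exact: cF.
move=> p q [Up U'p] [Uq U'q] /=; apply: le_trans (Ul _ _ U'p U'q) _.
by rewrite -mulrA ler_wpM2l // Uk.
Qed.

Lemma strict_diff_lip n (W : normedModType R) (F : 'rV[R]_n -> W) a
    (L : {linear 'rV[R]_n -> W}) :
  strict_diff F a L -> exists2 K, 0 < K & lip_near K F a.
Proof.
move=> /(_ 1 ltr01)[U aU U1]; have [K K0 LK] := linear_rV_bound L.
exists (1 + K); first by rewrite addr_gt0.
exists U => // p q Up Uq.
have -> : F p - F q = (F p - L p - (F q - L q)) + L (p - q).
  by rewrite subrACA -(linearB L) subrK.
apply: le_trans (ler_normD _ _) _.
by rewrite mulrDl lerD // U1.
Qed.

(** The error of G \o F splits into the error of G at values of F, controlled by
the Lipschitz constant K of F, and the error of F, amplified by at most the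
norm bound K' of L'. *)
Lemma strict_diff_comp m n (X : normedModType R) (F : 'rV[R]_m -> 'rV[R]_n)
    (G : 'rV[R]_n -> X) a (L : {linear 'rV[R]_m -> 'rV[R]_n})
    (L' : {linear 'rV[R]_n -> X}) :
  {for a, continuous F} -> strict_diff F a L -> strict_diff G (F a) L' ->
  strict_diff (G \o F) a (L' \o L).
Proof.
move=> cF sF sG e e0; have [K K0 [U1 aU1 FK]] := strict_diff_lip sF.
have [K' K'0 LK] := linear_rV_bound L'.
have [|U2 aU2 F2] := sF (e / 2 / K'); first by rewrite !divr_gt0.
have [|U3 aU3 G3] := sG (e / 2 / K); first by rewrite !divr_gt0.
exists (U1 `&` (U2 `&` F @^-1` U3)).
  by apply: filterI => //; apply: filterI => //; exact: cF.
move=> p q [U1p [U2p U3p]] [U1q [U2q U3q]] /=.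
have -> : G (F p) - L' (L p) - (G (F q) - L' (L q)) =
    (G (F p) - L' (F p) - (G (F q) - L' (F q))) + L' (F p - L p - (F q - L q)).
  rewrite (subrACA (G (F p))) [in RHS](subrACA (G (F p))) (subrACA (F p)).
  by rewrite -!(linearB L') -(linearB L) (linearB L' _ (L _)) subrKA.
apply: le_trans (ler_normD _ _) _.
rewrite [e]splitr mulrDl lerD //.
  apply: le_trans (G3 _ _ U3p U3q) _.
  by rewrite -mulrA ler_pM2l ?divr_gt0 // ler_pdivrMl // FK.
apply: le_trans (LK _) _; rewrite -ler_pdivlMl // mulrA [_^-1 * _]mulrC.
exact: F2.
Qed.

End LipschitzStrict.

(** * Maps of class C^1 are strictly differentiable *)

Section ContinuouslyDifferentiable.
Context {R : realType}.

(** The norm being the sup norm, the mean value theorem applied to each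
coordinate gives the bound without any loss, although the intermediate points
differ. *)
Lemma mean_value_rV n (h : R -> 'rV[R]_n) k :
  (forall t : R, 0 <= t <= 1 -> derivable h t 1) ->
  (forall t : R, 0 <= t <= 1 -> `|'D_1 h t| <= k) ->
  `|h 1 - h 0| <= k.
Proof.
move=> dh hk.
have in01 (t : R) : t \in `]0, 1[%R -> 0 <= t <= 1.
  by rewrite in_itv /= => /andP[/ltW-> /ltW->].
have k0 : 0 <= k.
  by apply: le_trans (normr_ge0 _) (hk 0 _); rewrite lexx ler01.
apply: norm_le_coord => // i; rewrite !mxE.
have dhi (t : R) : 0 <= t <= 1 ->
    is_derive t 1 (fun s => h s ord0 i) ('D_1 h t ord0 i).
  move=> t01; have dt := dh t t01; apply: DeriveDef.
    by move/derivable_mxP: dt; apply.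
  by rewrite derive_mx // mxE.
have [| |c /in01 c01 ->] := @MVT R (fun s => h s ord0 i)
  (fun t => 'D_1 h t ord0 i) 0 1 ltr01.
- by move=> t /in01; exact: dhi.
- apply: derivable_within_continuous => t; rewrite in_itv /= => t01.
  by have [] := dhi t t01.
by rewrite subr0 mulr1; apply: le_trans (coord_le_norm _ _) (hk c c01).
Qed.

(** On a ball around a where all partial derivatives are close to their values
at a, the derivative of f - 'd f a is small, and the ball is convex. *)
Lemma C1_strict_diff m n (U : set 'rV[R]_m) (f : 'rV[R]_m -> 'rV[R]_n) a :
  open U -> U a -> Ck_on 1 U f -> strict_diff f a ('d f a).
Proof.
move=> oU Ua [df cDf] e e0.
(* There are m partial derivatives; m.+1 avoids a division by zero if m = 0. *)
pose e1 := e / (m.+1)%:R.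
have e10 : 0 < e1 by rewrite divr_gt0.
have near_partial (j : 'I_m) : \forall z \near a,
    `|'D_(delta_mx ord0 j) f z - 'D_(delta_mx ord0 j) f a| <= e1.
  have /cvgrPdist_le/(_ e1 e10) := cDf (delta_mx ord0 j) a Ua.
  by apply: filterS => z; rewrite distrC.
have : nbhs a (U `&` [set z | forall j,
    `|'D_(delta_mx ord0 j) f z - 'D_(delta_mx ord0 j) f a| <= e1]).
  exact: filterI (open_nbhs_nbhs (conj oU Ua)) (filter_forall _ near_partial).
move=> /nbhs_ballP[r /= r0 rU].
exists (ball a r); first exact: nbhsx_ballx.
move=> q p aq ap.
pose l (t : R) := p + t *: (q - p).
have lr (t : R) : 0 <= t <= 1 -> ball a r (l t).
  move=> /andP[t0 t1]; move: aq ap; rewrite -!ball_normE /= => aq ap.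
  have -> : a - l t = (1 - t) *: (a - p) + t *: (a - q).
    by apply/rowP => i; rewrite !mxE; ring.
  apply: le_lt_trans (ler_normD _ _) _; rewrite !normrZ !ger0_norm ?subr_ge0 //.
  set x := `|a - p| in ap *; set y := `|a - q| in aq *.
  apply: (@le_lt_trans _ _ (Num.max x y)); last by rewrite gt_max ap.
  have : x <= Num.max x y by rewrite le_max lexx.
  have : y <= Num.max x y by rewrite le_max lexx orbT.
  nra.
pose g y := f y - 'd f a y.
have dg (t : R) : 0 <= t <= 1 -> is_diff t (g \o l)
    ((fun v => 'd f (l t) v - 'd f a v) \o (fun s : R => s *: (q - p))).
  move=> /lr/rU[Ul _].
  have dl : is_diff t l ( *:%R^~ (q - p)).
    have := is_diffD (is_diff_cst p t) (is_diff_scalel t (q - p)).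
    by rewrite add0r.
  have dlin : is_diff (l t) ('d f a) ('d f a).
    have cda : continuous ('d f a) by exact: linear_rV_continuous.
    by apply: DiffDef; [exact: linear_differentiable | exact: diff_lin].
  exact: is_diff_comp dl (is_diffB (differentiableP (df _ Ul)) dlin).
have <- : l 1 = q by rewrite /l scale1r addrCA subrr addr0.
have <- : l 0 = p by rewrite /l scale0r addr0.
have -> : l 1 - l 0 = q - p.
  by rewrite /l scale1r scale0r addr0 addrAC subrr add0r.
apply: (@mean_value_rV n (g \o l)).
  by move=> t /dg[]/derivable1_diffP.
move=> t t01; have [dt dtE] := dg t t01.
rewrite deriveE // dtE /= scale1r; have [Ult lt_e1] := rU _ (lr t t01).
have partials j :
    `|'d f (l t) (delta_mx ord0 j) - 'd f a (delta_mx ord0 j)| <= e1.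
  by have := lt_e1 j; rewrite (deriveE _ (df _ Ult)) (deriveE _ (df _ Ua)).
apply: le_trans (linear_sub_bound (q - p) partials) _.
rewrite ler_wpM2r // /e1 -(mulr_natr _ m) mulrAC ler_pdivrMr //.
by rewrite ler_pM2l // ler_nat.
Qed.

End ContinuouslyDifferentiable.

(** * Limits of secants *)

Lemma closed_le_fun (R : realType) (T : topologicalType) (g h : T -> R) :
  continuous g -> continuous h -> closed [set x | g x <= h x].
Proof.
move=> cg ch.
have -> : [set x | g x <= h x] = (g \- h) @^-1` [set t | t <= 0].
  by apply/seteqP; split=> x /=; rewrite subr_le0.
apply: preimage_closed; last exact: closed_le.
by move=> x _; apply: continuousB; [exact: cg | exact: ch].
Qed.

Lemma continuous_mull (R : realType) (T : topologicalType) (k : R)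
    (g : T -> R) :
  continuous g -> continuous (fun x => k * g x).
Proof. by move=> cg x; apply: cvgMl_tmp; exact: cg. Qed.

Section NormContinuity.
Context {R : realType} {m n : nat}.

Lemma continuous_norm_lsubmx :
  continuous (fun w : 'rV[R]_(m + n) => `|lsubmx w|).
Proof.
by move=> w; apply: continuous_comp;
  [exact: continuous_lsubmx | exact: norm_continuous].
Qed.

Lemma continuous_norm_rsubmx :
  continuous (fun w : 'rV[R]_(m + n) => `|rsubmx w|).
Proof.
by move=> w; apply: continuous_comp;
  [exact: continuous_rsubmx | exact: norm_continuous].
Qed.

Lemma continuous_norm_off_graph (L : {linear 'rV[R]_m -> 'rV[R]_n}) :
  continuous (fun w : 'rV[R]_(m + n) => `|rsubmx w - L (lsubmx w)|).
Proof.
move=> w; apply: continuous_comp; last exact: norm_continuous.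
apply: continuousB; first exact: continuous_rsubmx.
by apply: continuous_comp;
  [exact: continuous_lsubmx | exact: linear_rV_continuous].
Qed.

End NormContinuity.

Section SecantCone.
Context {R : realType}.

Definition secants (V W : normedModType R) (G : V -> W) (a : V) (e : R) :
    set W :=
  [set s | exists p q c,
    [/\ ball a e p, ball a e q, 0 < c & s = c *: (G q - G p)]].

(** For G p = (p, F p) this is the Whitney cone of the graph of F with itself.
The formulation by closures, rather than by sequences, makes it a set of cluster
points, to which compactness applies directly. *)
Definition secant_cone (V W : normedModType R) (G : V -> W) (a : V) : set W :=
  \bigcap_(e in [set e : R | 0 < e]) closure (secants G a e).

Lemma secants_le (V W : normedModType R) (G : V -> W) a e e' :
  e <= e' -> secants G a e `<=` secants G a e'.
Proof.
move=> ee' s [p [q [c [ap aq c0 ->]]]].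
by exists p, q, c; split=> //; exact: le_ball ee' _ _.
Qed.

Lemma secant_cone_sub_closed (V W : normedModType R) (G : V -> W) a e P :
  0 < e -> closed P -> secants G a e `<=` P -> secant_cone G a `<=` P.
Proof. by move=> e0 cP sP w /(_ e e0) /(closureS sP) /cP. Qed.

Lemma closure_ball (W : normedModType R) (A : set W) w :
  (forall e, 0 < e -> exists2 s, A s & ball w e s) -> closure A w.
Proof.
move=> Aw B /nbhs_ballP[e /= e0 eB]; have [s As ws] := Aw e e0.
by exists s; split=> //; exact: eB.
Qed.

(** The compactness argument: if bounded secants with a closed property Q e
occur at every scale e, then a cluster point of them is in the cone and has all
the properties Q e.  Letting Q depend on the scale allows properties such as
having a first component of norm at most e. *)
Lemma secant_cone_meet (V : normedModType R) n (G : V -> 'rV[R]_n) a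
    (Q : R -> set 'rV[R]_n) r :
  (forall e e', e <= e' -> Q e `<=` Q e') -> (forall e, closed (Q e)) ->
  (forall e, 0 < e -> e <= 1 ->
     exists2 s, secants G a e s & Q e s /\ `|s| <= r) ->
  exists2 w, secant_cone G a w & forall e, 0 < e -> Q e w.
Proof.
move=> Qle Qcl QG.
pose D := [set e : R | 0 < e /\ e <= 1].
pose B e := [set s | secants G a e s /\ Q e s] `&` [set s | `|s| <= r].
pose F := filter_from D B.
have FF : ProperFilter F.
  apply: filter_from_proper; last first.
    by move=> e [e0 e1]; have [s Gs [Qs sr]] := QG e e0 e1; exists s.
  apply: filter_from_filter; first by exists 1; split.
  move=> e e' [e0 e1] [e'0 e'1]; exists (Num.min e e').
    by split; [rewrite lt_min e0 | rewrite ge_min e1].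
  move=> s [[Gs Qs] sr]; split; split=> //; split.
  - by apply: secants_le Gs; rewrite ge_min lexx.
  - by apply: Qle Qs; rewrite ge_min lexx.
  - by apply: secants_le Gs; rewrite ge_min lexx orbT.
  - by apply: Qle Qs; rewrite ge_min lexx orbT.
pose K := [set s : 'rV[R]_n | `|s| <= r].
have cK : compact K.
  apply: bounded_closed_compact.
    exists r; split=> [|x rx s /= sr]; first exact: num_real.
    exact: le_trans sr (ltW rx).
  by apply: closed_le_fun; [exact: norm_continuous | exact: cst_continuous].
have FK : F K by exists 1 => [|s []//]; split.
have [w [_ Fw]] := cK F FF FK.
have Dw e : 0 < e -> closure (B (Num.min e 1)) w.
  move=> e0 A wA; apply: Fw => //; exists (Num.min e 1) => //.
  by split; [rewrite lt_min e0 ltr01 | rewrite ge_min lexx orbT].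
exists w => [e /= e0|e e0].
  apply: closureS (Dw e e0) => s [[Gs _] _].
  by apply: secants_le Gs; rewrite ge_min lexx.
apply: Qcl; apply: closureS (Dw e e0) => s [[_ Qs] _].
by apply: Qle Qs; rewrite ge_min lexx.
Qed.

End SecantCone.

(** * The cone of a graph *)

Section GraphCone.
Context {R : realType}.
Variables (m n : nat) (F : 'rV[R]_m -> 'rV[R]_n) (a : 'rV[R]_m).

Definition graph_map (p : 'rV[R]_m) : 'rV[R]_(m + n) := row_mx p (F p).

Lemma graph_secantE (c : R) p q :
  c *: (graph_map q - graph_map p) = row_mx (c *: (q - p)) (c *: (F q - F p)).
Proof. by rewrite /graph_map opp_row_mx add_row_mx scale_row_mx. Qed.

Lemma small_step u e : 0 < e -> exists2 t : R, 0 < t & ball a e (a + t *: u).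
Proof.
move=> e0.
(* The summand 1 covers the case u = 0. *)
have u1 : 0 < 1 + `|u| by rewrite ltr_pwDl.
exists (e / (1 + `|u|)); first by rewrite divr_gt0.
rewrite -ball_normE /= opprD addNKr normrN normrZ gtr0_norm ?divr_gt0 //.
by rewrite mulrAC ltr_pdivrMr // ltr_pM2l // ltrDr.
Qed.

Lemma radial_secantE t u : t != 0 ->
  t^-1 *: (graph_map (a + t *: u) - graph_map a) =
  row_mx u (t^-1 *: (F (a + t *: u) - F a)).
Proof.
move=> t0; rewrite graph_secantE; congr row_mx.
by rewrite addrAC subrr add0r scalerA mulVf // scale1r.
Qed.

Lemma graph_cone_lip K w : lip_near K F a -> secant_cone graph_map a w ->
  `|rsubmx w| <= K * `|lsubmx w|.
Proof.
move=> [U /nbhs_ballP[e /= e0 eU] UK]; move: w.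
apply: (@secant_cone_sub_closed _ _ _ _ _ e
  [set w | `|rsubmx w| <= K * `|lsubmx w|]) => //.
  apply: closed_le_fun; first exact: continuous_norm_rsubmx.
  exact: continuous_mull continuous_norm_lsubmx.
move=> s [p [q [c [/eU Up /eU Uq c0 ->]]]] /=.
rewrite graph_secantE row_mxKl row_mxKr !normrZ mulrCA.
by rewrite ler_wpM2l // UK.
Qed.

(** Where F is not e^-1-Lipschitz on the ball of radius e, there is a secant
with second component of norm 1 and first component of norm at most e. *)
Lemma cone0_trivial_lip :
  (forall v, secant_cone graph_map a (row_mx 0 v) -> v = 0) ->
  exists2 K, 0 < K & lip_near K F a.
Proof.
move=> cone0; apply: contrapT => nlip.
pose Q e := [set s : 'rV[R]_(m + n) | `|lsubmx s| <= e] `&`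
   [set s | 1 <= `|rsubmx s|].
have [||e e0 e1|w conew Qw] := @secant_cone_meet R _ _ graph_map a Q 1.
- by move=> e e' ee' s [/= se s1]; split=> //=; exact: le_trans ee'.
- move=> e; apply: closedI; apply: closed_le_fun;
    by [exact: continuous_norm_lsubmx | exact: continuous_norm_rsubmx
      | exact: cst_continuous].
- have /existsNP[p /existsNP[q /not_implyP[ap /not_implyP[aq]]]] :
      ~ forall p q, ball a e p -> ball a e q -> `|F p - F q| <= e^-1 * `|p - q|.
    move=> lipe; apply: nlip; exists e^-1; first by rewrite invr_gt0.
    by exists (ball a e); [exact: nbhsx_ballx | exact: lipe].
  move=> /negP; rewrite -ltNge => eFpq.
  have Fpq0 : 0 < `|F p - F q|.
    by apply: le_lt_trans eFpq; rewrite mulr_ge0 // invr_ge0 ltW.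
  exists (`|F p - F q|^-1 *: (graph_map p - graph_map q)).
    by exists q, p, (`|F p - F q|^-1); split=> //; rewrite invr_gt0.
  have le_e : `| `|F p - F q|^-1 *: (p - q)| <= e.
    rewrite normrZ gtr0_norm ?invr_gt0 // ler_pdivrMl // mulrC -ler_pdivrMl //.
    exact: ltW.
  have eq1 : `| `|F p - F q|^-1 *: (F p - F q)| = 1.
    by rewrite normrZ gtr0_norm ?invr_gt0 // mulVf // gt_eqF.
  rewrite graph_secantE /Q /=; split; first by rewrite row_mxKl row_mxKr eq1.
  by apply: norm_row_mx_le; [exact: le_trans e1 | rewrite eq1].
have lw0 : lsubmx w = 0.
  apply/eqP; rewrite -normr_le0; apply/ler_addgt0Pr => e e0.
  by rewrite add0r; have [] := Qw e e0.
have [_ /=] := Qw 1 ltr01.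
rewrite (cone0 (rsubmx w)); last by rewrite -lw0 hsubmxK.
by rewrite normr0 ler10.
Qed.

(** Secants from a in direction u, scaled to have first component u, have a
second component bounded by K |u|. *)
Lemma lip_cone_total K u : 0 <= K -> lip_near K F a ->
  exists v, secant_cone graph_map a (row_mx u v).
Proof.
move=> K0 [U /nbhs_ballP[d /= d0 dU] UK].
pose Q (e : R) := [set s : 'rV[R]_(m + n) | lsubmx s = u].
have [||e e0 e1|w conew Qw] :=
    @secant_cone_meet R _ _ graph_map a Q ((1 + K) * `|u|).
- by move=> e e' _ s.
- move=> e.
  have -> : Q e = [set s | `|lsubmx s - u| <= 0].
    apply/seteqP; split=> s /=.
      by rewrite /Q /= => ->; rewrite subrr normr0.
    by rewrite normr_le0 subr_eq0 => /eqP.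
  apply: closed_le_fun => w; last exact: cst_continuous.
  apply: continuous_comp; last exact: norm_continuous.
  by apply: continuousB; [exact: continuous_lsubmx | exact: cst_continuous].
- have [|t t0] := @small_step u (Num.min e d); first by rewrite lt_min e0.
  move=> step; exists (t^-1 *: (graph_map (a + t *: u) - graph_map a)).
    exists a, (a + t *: u), t^-1; split; rewrite ?invr_gt0 //.
      exact: ballxx.
    by apply: le_ball step; rewrite ge_min lexx.
  rewrite radial_secantE ?gt_eqF // /Q /= row_mxKl; split=> //.
  apply: norm_row_mx_le; first by rewrite mulrDl mul1r lerDl mulr_ge0.
  rewrite normrZ gtr0_norm ?invr_gt0 // ler_pdivrMl //.
  apply: le_trans (UK _ _ _ _) _.
  - by apply: dU; apply: le_ball step; rewrite ge_min lexx orbT.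
  - by apply: dU; exact: ballxx.
  rewrite addrAC subrr add0r normrZ gtr0_norm // mulrCA ler_pM2l //.
  by rewrite ler_wpM2r // lerDr.
by exists (rsubmx w); rewrite -(Qw 1 ltr01) hsubmxK.
Qed.

(** Secants near a stay within e |u| of the graph of L, for every e > 0; and
(u, L u) is the limit of the secants from a in direction u. *)
Lemma strict_diff_cone (L : {linear 'rV[R]_m -> 'rV[R]_n}) :
  strict_diff F a L ->
  secant_cone graph_map a = [set row_mx u (L u) | u in [set: 'rV[R]_m]].
Proof.
move=> sF; apply/seteqP; split=> [w conew|_ [u _ <-]].
  exists (lsubmx w) => //; rewrite -[RHS]hsubmxK; congr row_mx.
  apply/eqP; rewrite eq_sym -subr_eq0 -normr_le0; apply/ler_addgt0Pr => e e0.
  rewrite add0r.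
  have e'0 : 0 < e / (1 + `|lsubmx w|) by rewrite divr_gt0 // ltr_pwDl.
  have [U /nbhs_ballP[d /= d0 dU] Ue] := sF _ e'0.
  apply: (@le_trans _ _ (e / (1 + `|lsubmx w|) * `|lsubmx w|)); last first.
    by rewrite mulrAC ler_pdivrMr ?ltr_pwDl // ler_pM2l // lerDr.
  move: w conew (e / _) e'0 Ue => w0 conew e' e'0 Ue.
  move: w0 conew.
  apply: (@secant_cone_sub_closed _ _ _ _ _ d
    [set w | `|rsubmx w - L (lsubmx w)| <= e' * `|lsubmx w|]) => //.
    apply: closed_le_fun; first exact: continuous_norm_off_graph.
    exact: continuous_mull continuous_norm_lsubmx.
  move=> s [p [q [c [/dU Up /dU Uq c0 ->]]]] /=.
  rewrite graph_secantE row_mxKl row_mxKr linearZ -scalerBr !normrZ mulrCA.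
  by rewrite ler_wpM2l // linearB -subrACA Ue.
move=> e /= e0; apply: closure_ball => r r0.
have e'0 : 0 < r / (1 + `|u|) by rewrite divr_gt0 // ltr_pwDl.
have [U /nbhs_ballP[d /= d0 dU] Ue] := sF _ e'0.
have [|t t0] := @small_step u (Num.min e d); first by rewrite lt_min e0.
move=> step; exists (t^-1 *: (graph_map (a + t *: u) - graph_map a)).
  exists a, (a + t *: u), t^-1; split; rewrite ?invr_gt0 //.
    exact: ballxx.
  by apply: le_ball step; rewrite ge_min lexx.
rewrite radial_secantE ?gt_eqF // -ball_normE /= opp_row_mx add_row_mx subrr.
apply: (@le_lt_trans _ _ (r / (1 + `|u|) * `|u|)); last first.
  by rewrite mulrAC ltr_pdivrMr ?ltr_pwDl // ltr_pM2l // ltrDr.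
apply: norm_row_mx_le; first by rewrite normr0 mulr_ge0 // ltW.
have -> : L u - t^-1 *: (F (a + t *: u) - F a) =
    t^-1 *: (F a - L a - (F (a + t *: u) - L (a + t *: u))).
  rewrite subrACA -(linearB L) opprD addrA subrr sub0r (linearN L) /= opprK.
  rewrite (linearZ_LR L) [in RHS]scalerDr scalerA mulVf ?gt_eqF // scale1r.
  by rewrite addrC -scalerN opprB.
rewrite normrZ gtr0_norm ?invr_gt0 // ler_pdivrMl //.
apply: le_trans (Ue _ _ _ _) _.
- by apply: dU; exact: ballxx.
- by apply: dU; apply: le_ball step; rewrite ge_min lexx orbT.
by rewrite opprD addrA subrr sub0r normrN normrZ gtr0_norm // mulrCA.
Qed.

(** Otherwise there are secants, scaled to have a first component u of norm 1,
whose second component differs from L u by at least e0; the Lipschitz bound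
keeps them in a compact set. *)
Lemma graph_cone_strict (L : {linear 'rV[R]_m -> 'rV[R]_n}) K :
  lip_near K F a ->
  (forall w, secant_cone graph_map a w -> rsubmx w = L (lsubmx w)) ->
  strict_diff F a L.
Proof.
move=> [U /nbhs_ballP[d /= d0 dU] UK] coneL e0 e00; apply: contrapT => nlip.
pose Q (e : R) := [set s : 'rV[R]_(m + n) | e0 <= `|rsubmx s - L (lsubmx s)|].
have [||e e_gt0 e1|w conew Qw] :=
    @secant_cone_meet R _ _ graph_map a Q (Num.max 1 K).
- by move=> e e' _ s.
- move=> e; apply: closed_le_fun; first exact: cst_continuous.
  exact: continuous_norm_off_graph.
- pose r := Num.min e d.
  have r0 : 0 < r by rewrite lt_min e_gt0.
  have /existsNP[p /existsNP[q /not_implyP[ap /not_implyP[aq]]]] :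
      ~ forall p q, ball a r p -> ball a r q ->
        `|F p - L p - (F q - L q)| <= e0 * `|p - q|.
    move=> lipr; apply: nlip.
    by exists (ball a r); [exact: nbhsx_ballx | exact: lipr].
  move=> /negP; rewrite -ltNge => eFpq.
  have pq0 : 0 < `|p - q|.
    rewrite normr_gt0 subr_eq0; apply: contraTneq eFpq => ->.
    by rewrite !subrr !normr0 mulr0 ltxx.
  exists (`|p - q|^-1 *: (graph_map p - graph_map q)).
    exists q, p, (`|p - q|^-1); split; rewrite ?invr_gt0 //.
      by apply: le_ball aq; rewrite ge_min lexx.
    by apply: le_ball ap; rewrite ge_min lexx.
  have eq1 : `| `|p - q|^-1 *: (p - q)| = 1.
    by rewrite normrZ gtr0_norm ?invr_gt0 // mulVf // gt_eqF.
  rewrite graph_secantE /Q /= row_mxKl row_mxKr; split.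
    rewrite linearZ -scalerBr normrZ gtr0_norm ?invr_gt0 //.
    by rewrite ler_pdivlMl // mulrC linearB -subrACA ltW.
  apply: norm_row_mx_le; first by rewrite eq1 le_max lexx.
  rewrite normrZ gtr0_norm ?invr_gt0 // ler_pdivrMl // mulrC.
  apply: (@le_trans _ _ (K * `|p - q|)).
    by apply: UK; apply: dU; [apply: le_ball ap | apply: le_ball aq];
      rewrite ge_min lexx orbT.
  by rewrite ler_wpM2r // le_max lexx orbT.
have := Qw 1 ltr01; rewrite /Q /=.
by rewrite coneL // subrr normr0 leNgt e00.
Qed.

End GraphCone.

(** * Subspaces that are graphs *)

Section GraphSubspace.
Variables (K : fieldType) (m n : nat).

Lemma graph_vspace (L : {linear 'rV[K]_m -> 'rV[K]_n}) :
  exists W : {vspace 'rV[K]_(m + n)},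
    \dim W = m /\ forall u, row_mx u (L u) \in W.
Proof.
have linG : linear (fun u => row_mx u (L u)).
  by move=> c u v; rewrite linearP scale_row_mx add_row_mx.
pose G : {linear _ -> _} := HB.pack (fun u => row_mx u (L u))
  (GRing.isLinear.Build _ _ _ _ _ linG).
exists (limg (linfun G)); split; last first.
  move=> u; apply/memv_imgP.
  by exists u; [exact: memvf | exact: esym (lfunE G u)].
rewrite limg_dim_eq ?dimvf /dim /= ?mul1n //.
apply/eqP; rewrite capfv; apply/lker0P => u v.
by rewrite (lfunE G u) (lfunE G v) => /eq_row_mx[].
Qed.

(** The projection of W on the first factor is onto, hence injective since W has
dimension m; L is its inverse followed by the second projection. *)
Lemma vspace_graph (W : {vspace 'rV[K]_(m + n)}) :
  \dim W = m -> (forall u, exists v, row_mx u v \in W) ->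
  exists L : {linear 'rV[K]_m -> 'rV[K]_n},
    forall w, w \in W -> rsubmx w = L (lsubmx w).
Proof.
move=> dimW exW.
pose pr : 'Hom('rV[K]_(m + n), 'rV[K]_m) := linfun lsubmx.
have prE w : pr w = lsubmx w by rewrite lfunE.
have prW : (pr @: W = fullv)%VS.
  apply/eqP; rewrite eqEsubv subvf /=; apply/subvP => u _.
  have [v Wv] := exW u; apply/memv_imgP; exists (row_mx u v) => //.
  by rewrite prE row_mxKl.
have ker0 w : w \in W -> lsubmx w = 0 -> w = 0.
  move=> Ww w0; have := limg_ker_dim pr W.
  rewrite prW dimvf /dim /= mul1n dimW => /(canRL (addnK _)).
  rewrite subnn => /eqP; rewrite dimv_eq0 => /eqP k0.
  by apply/eqP; rewrite -memv0 -k0 memv_cap Ww memv_ker prE w0 eqxx.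
have [h Wh] := choice exW.
have hE w : w \in W -> rsubmx w = h (lsubmx w).
  move=> Ww; apply/eqP; rewrite -subr_eq0 -[X in X - _](row_mxKr (lsubmx w)).
  rewrite hsubmxK -[X in _ - X](row_mxKr (lsubmx w)) -linearB.
  rewrite (ker0 (w - _)) ?linear0 //.
    by apply: memvB; [exact: Ww | exact: Wh].
  by rewrite linearB /= row_mxKl subrr.
have linh : linear h.
  move=> c u v; have : c *: row_mx u (h u) + row_mx v (h v) \in W.
    by apply: memvD; [apply: memvZ|]; exact: Wh.
  by move/hE; rewrite scale_row_mx add_row_mx row_mxKl row_mxKr.
pose L : {linear _ -> _} := HB.pack h (GRing.isLinear.Build _ _ _ _ _ linh).
by exists L.
Qed.

End GraphSubspace.

(** * Charts and transition maps *)

Section Charts.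
Context {R : realType}.

(** Pulls a neighborhood of x back to coordinates, together with the fact that
[cinv phi] is a right inverse of [cmap phi] there. *)
Lemma near_chart (T : topologicalType) (phi : chart R T) x (A : set T) :
  csrc phi x -> nbhs x A -> \forall p \near cmap phi x,
    [/\ csrc phi (cinv phi p), A (cinv phi p) & cmap phi (cinv phi p) = p].
Proof.
move=> sx xA; have oA := @open_cmap_image R T phi _ (@open_interior T A).
have Ax : (cmap phi @` (csrc phi `&` A°)) (cmap phi x) by exists x.
apply: filterS (open_nbhs_nbhs (conj oA Ax)).
by move=> _ [y [sy /interior_subset Ay] <-]; rewrite cmapK.
Qed.

Lemma near_src (T : topologicalType) (phi : chart R T) x :
  csrc phi x -> nbhs x (csrc phi).
Proof. by move=> sx; apply: open_nbhs_nbhs; split=> //; exact: csrc_open. Qed.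

Lemma cinv_cont_at (T : topologicalType) (phi : chart R T) x :
  csrc phi x -> cinv phi p @[p --> cmap phi x] --> x.
Proof.
by move=> sx; rewrite -{2}(cmapK sx); apply: cinv_cont; exists x.
Qed.

Section Transition.
Variables (T : topologicalType) (phi psi : chart R T) (x : T).
Hypotheses (phix : csrc phi x) (psix : csrc psi x).

Lemma transition_at : transition phi psi (cmap phi x) = cmap psi x.
Proof. by rewrite /transition cmapK. Qed.

Lemma transition_cont : {for cmap phi x, continuous (transition phi psi)}.
Proof.
rewrite /prop_for /continuous_at transition_at.
by apply: cvg_comp (cinv_cont_at phix) _; exact: cmap_cont.
Qed.

Lemma near_transitionK :
  \forall p \near cmap phi x, transition psi phi (transition phi psi p) = p.
Proof.
apply: filterS (near_chart phix (near_src psix)) => p [sp sp' pE].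
by rewrite /transition cmapK.
Qed.

Lemma transition_C1 : smooth_transition phi psi ->
  differentiable (transition phi psi) (cmap phi x) /\
  strict_diff (transition phi psi) (cmap phi x)
    ('d (transition phi psi) (cmap phi x)).
Proof.
move=> sm; have imx : (cmap phi @` (csrc phi `&` csrc psi)) (cmap phi x).
  by exists x.
split; first by have [df _] := sm 1%N; exact: df.
apply: (C1_strict_diff _ imx (sm 1%N)).
by apply: open_cmap_image; exact: csrc_open.
Qed.

End Transition.

Lemma near_id_diff (V : normedModType R) (g : V -> V) a v :
  {near a, g =1 id} -> 'd g a v = v.
Proof.
move=> gid; have gid' : {near a, id =1 g} by apply: filterS gid => p ->.
have dg : differentiable g a by exact: near_eq_differentiable gid' _.
by rewrite -deriveE // (near_eq_derive v gid) deriveE // diff_val.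
Qed.

Lemma chart_diffK (T : topologicalType) (phi psi : chart R T) x v :
  csrc phi x -> csrc psi x ->
  smooth_transition phi psi -> smooth_transition psi phi ->
  'd (transition psi phi) (cmap psi x) ('d (transition phi psi) (cmap phi x) v)
    = v.
Proof.
move=> sx sx' sm sm'.
have [d1 _] := transition_C1 sx sx' sm; have [d2 _] := transition_C1 sx' sx sm'.
rewrite -(transition_at psi sx) in d2.
have := congr1 (fun h => h v) (diff_comp d1 d2).
rewrite [in RHS]/= transition_at // => <-.
by apply: near_id_diff; exact: near_transitionK.
Qed.

End Charts.

(** * The Whitney cone in coordinates *)

Section Cone.
Context {R : realType}.
Variables (M N : smooth_space R) (f : M -> N) (x : M).
Hypothesis fx : {for x, continuous f}.

Local Notation phi := (chart_at M x).
Local Notation psi := (chart_at N (f x)).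
Local Notation F := (@local_rep _ _ _ f phi psi).

(** In coordinates the sequences of the Whitney cone give secants at every
scale; conversely, secants at the scales 1 / (k + 1) lift to sequences on the
graph of f, which converge to (x, f x) because f and the inverse chart are
continuous. *)
Lemma fcone_secant :
  fcone f x = secant_cone (graph_map F) (cmap phi x).
Proof.
have sphi : csrc phi x by exact: mem_chart_at.
have spsi : csrc psi (f x) by exact: mem_chart_at.
apply/seteqP; split=> w.
  move=> [X [Y [c [XYc Xx Yx cw]]]] e /= e0; apply: closure_ball => r r0.
  have near_good (Z : nat -> prod_space M N) : Z n @[n --> \oo] --> (x, f x) ->
      \forall n \near \oo, ball (cmap phi x) e (cmap phi (Z n).1) /\
        csrc phi (Z n).1.
    move=> Zx; have Z1 : (Z n).1 @[n --> \oo] --> x.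
      exact: (cvg_comp _ _ Zx cvg_fst).
    have Z2 : cmap phi (Z n).1 @[n --> \oo] --> cmap phi x.
      exact: (cvg_comp _ _ Z1 (cmap_cont sphi)).
    have Z2e : \forall n \near \oo, ball (cmap phi x) e (cmap phi (Z n).1).
      exact: Z2 _ (nbhsx_ballx _ _ e0).
    have Z1s : \forall n \near \oo, csrc phi (Z n).1.
      exact: Z1 _ (near_src sphi).
    by apply: filterS2 Z2e Z1s => n.
  have cwr : \forall n \near \oo, ball w r (c n *:
      (prod_cmap phi psi (Y n) - prod_cmap phi psi (X n))).
    exact: cw _ (nbhsx_ballx w r r0).
  have [n [[aX sX] [aY sY] wr]] :
      exists n, [/\ ball (cmap phi x) e (cmap phi (X n).1) /\ csrc phi (X n).1,
        ball (cmap phi x) e (cmap phi (Y n).1) /\ csrc phi (Y n).1 &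
        ball w r (c n *: (prod_cmap phi psi (Y n) - prod_cmap phi psi (X n)))].
    apply: (@filter_ex _ \oo).
    by apply: filterS3 (near_good X Xx) (near_good Y Yx) cwr => n.
  have [gX gY c0] := XYc n.
  exists (c n *: (graph_map F (cmap phi (Y n).1) -
                  graph_map F (cmap phi (X n).1))).
    by exists (cmap phi (X n).1), (cmap phi (Y n).1), (c n).
  have GE (p : prod_space M N) : p.2 = f p.1 -> csrc phi p.1 ->
      graph_map F (cmap phi p.1) = prod_cmap phi psi p.
    by move=> gp sp; rewrite /graph_map /local_rep cmapK // -gp.
  by rewrite !GE.
move=> conew; pose e (k : nat) : R := k.+1%:R^-1.
have e0 k : 0 < e k by rewrite invr_gt0 ltr0n.
have ball_cvg (V : normedModType R) (u : nat -> V) v :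
    (forall k, ball v (e k) (u k)) -> u k @[k --> \oo] --> v.
  move=> vu; apply/cvg_ballP => r r0.
  have /cvgrPdist_lt /(_ r r0) := @cvg_harmonic R.
  apply: filterS => k; rewrite sub0r normrN gtr0_norm // => kr.
  exact: le_ball (ltW kr) _ (vu k).
have : forall k, exists z : 'rV[R]_(dim_at x) * 'rV[R]_(dim_at x) * R,
    [/\ ball (cmap phi x) (e k) z.1.1, ball (cmap phi x) (e k) z.1.2, 0 < z.2 &
     ball w (e k) (z.2 *: (graph_map F z.1.2 - graph_map F z.1.1))].
  move=> k; have [s [[p [q [c [ap aq c0 ->]]]] ws]] :=
    conew _ (e0 k) _ (nbhsx_ballx w _ (e0 k)).
  by exists (p, q, c).
move=> /choice[z zP].
pose lift p : prod_space M N := (cinv phi p, f (cinv phi p)).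
have liftE : \forall p \near cmap phi x,
    prod_cmap phi psi (lift p) = graph_map F p.
  by apply: filterS (near_chart sphi (near_src sphi)) => p [_ _ pE];
    rewrite /prod_cmap /= pE.
have lift_cvg : lift p @[p --> cmap phi x] --> (x, f x).
  exact: (cvg_pair (cinv_cont_at sphi) (cvg_comp _ _ (cinv_cont_at sphi) fx)).
have z1 : (z k).1.1 @[k --> \oo] --> cmap phi x.
  by apply: ball_cvg => k; have [] := zP k.
have z2 : (z k).1.2 @[k --> \oo] --> cmap phi x.
  by apply: ball_cvg => k; have [] := zP k.
exists (fun k => lift (z k).1.1), (fun k => lift (z k).1.2), (fun k => (z k).2).
split.
- by move=> k; have [_ _ c0 _] := zP k; split.
- exact: (cvg_comp _ _ z1 lift_cvg).
- exact: (cvg_comp _ _ z2 lift_cvg).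
have : (z k).2 *: (graph_map F (z k).1.2 - graph_map F (z k).1.1)
    @[k --> \oo] --> w.
  by apply: ball_cvg => k; have [] := zP k.
apply: cvg_trans; apply: near_eq_cvg.
have E1 : \forall k \near \oo,
    prod_cmap phi psi (lift (z k).1.1) = graph_map F (z k).1.1.
  exact: z1 _ liftE.
have E2 : \forall k \near \oo,
    prod_cmap phi psi (lift (z k).1.2) = graph_map F (z k).1.2.
  exact: z2 _ liftE.
by apply: filterS2 E1 E2 => k /= -> ->.
Qed.

End Cone.

(** * Change of charts *)

Section ChangeOfCharts.
Context {R : realType}.
Variables (M N : smooth_space R) (f : M -> N) (x : M).
Hypothesis fx : {for x, continuous f}.

Lemma local_rep_cont (phi : chart R M) (psi : chart R N) :
  csrc phi x -> csrc psi (f x) ->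
  {for cmap phi x, continuous (@local_rep _ _ _ f phi psi)}.
Proof.
move=> sphi spsi; rewrite /prop_for /continuous_at {2}/local_rep cmapK //.
exact: (cvg_comp _ _ (cvg_comp _ _ (cinv_cont_at sphi) fx) (cmap_cont spsi)).
Qed.

Variables (phi phi' : chart R M) (psi psi' : chart R N).
Hypotheses (sphi : csrc phi x) (sphi' : csrc phi' x).
Hypotheses (spsi : csrc psi (f x)) (spsi' : csrc psi' (f x)).
Local Notation F := (@local_rep _ _ _ f phi psi).
Local Notation F' := (@local_rep _ _ _ f phi' psi').
Local Notation tau := (transition phi phi').
Local Notation sigma := (transition psi' psi).

Lemma near_local_rep_change : {near cmap phi x, sigma \o (F' \o tau) =1 F}.
Proof.
have nA : nbhs x (csrc phi' `&` f @^-1` csrc psi').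
  by apply: filterI; [exact: near_src | exact: fx _ (near_src spsi')].
apply: filterS (near_chart sphi nA) => p [_ [sp' sfp'] _] /=.
by rewrite /transition /local_rep cmapK // cmapK.
Qed.

Lemma local_rep_tau_at : (F' \o tau) (cmap phi x) = cmap psi' (f x).
Proof. by rewrite /= transition_at // /local_rep cmapK. Qed.

Lemma local_rep_tau_cont : {for cmap phi x, continuous (F' \o tau)}.
Proof.
apply: continuous_comp; first exact: transition_cont.
by rewrite transition_at //; exact: local_rep_cont.
Qed.

Hypotheses (smM : smooth_transition phi phi').
Hypotheses (smN : smooth_transition psi' psi).

Lemma strict_diff_change (L : {linear _ -> _}) :
  strict_diff F' (cmap phi' x) L ->
  strict_diff F (cmap phi x) (fun u =>
    'd sigma (cmap psi' (f x)) (L ('d tau (cmap phi x) u))).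
Proof.
move=> sF'; have [_ stau] := transition_C1 sphi sphi' smM.
have [_ ssigma] := transition_C1 spsi' spsi smN.
apply: strict_diff_eq near_local_rep_change _.
have := @strict_diff_comp R _ _ _ (F' \o tau) sigma (cmap phi x)
  (L \o 'd tau (cmap phi x)) ('d sigma (cmap psi' (f x))).
apply; first exact: local_rep_tau_cont.
  apply: strict_diff_comp => //; first exact: transition_cont.
  by rewrite transition_at.
by rewrite local_rep_tau_at.
Qed.

Lemma lip_near_change K : 0 <= K -> lip_near K F' (cmap phi' x) ->
  exists K', lip_near K' F (cmap phi x).
Proof.
move=> K0 lF'.
have [_ /strict_diff_lip[k k0 ltau]] := transition_C1 sphi sphi' smM.
have [_ /strict_diff_lip[l l0 lsigma]] := transition_C1 spsi' spsi smN.
exists (l * (K * k)); apply: lip_near_eq near_local_rep_change _.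
apply: (@lip_near_comp _ _ _ _ _ _ (F' \o tau) sigma) => //.
- exact: ltW.
- exact: local_rep_tau_cont.
- apply: (@lip_near_comp _ _ _ _ _ _ tau F') => //.
    exact: transition_cont.
  by rewrite transition_at.
- by rewrite local_rep_tau_at.
Qed.

End ChangeOfCharts.

(** * Lipschitz and strictly differentiable maps of manifolds *)

Section Manifolds.
Context {R : realType}.
Variables (M N : smooth_space R) (f : M -> N) (x : M).
Local Notation phi := (chart_at M x).
Local Notation psi := (chart_at N (f x)).
Local Notation F := (@local_rep _ _ _ f phi psi).
Local Notation a := (cmap phi x).

Lemma chart_at_is_chart (P : smooth_space R) (y z : P) :
  csrc (chart_at P z) y -> is_chart_at y (chart_at P z).
Proof.
move=> sy; split=> // c ac; have az := chart_at_atlas z.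
by split; [exact: atlas_smooth az ac | exact: atlas_smooth ac az].
Qed.

(** The constant C + 1 of the given charts may be negative, whence the absolute
value. *)
Lemma lipschitz_at_lip_near : {for x, continuous f} -> lipschitz_at f x ->
  exists K, lip_near K F a.
Proof.
move=> fx [phi' [psi' [C [[sphi' smphi'] [spsi' smpsi'] lipC]]]].
have [U [[aU _] UC]] := lipC 1 ltr01.
have [_ smM] := smphi' _ (chart_at_atlas x).
have [smN _] := smpsi' _ (chart_at_atlas (f x)).
apply: (lip_near_change (phi' := phi') (psi' := psi') fx _ _ _ _ smM smN
  (normr_ge0 (C + 1))) => //; try exact: mem_chart_at.
exists U => // p q Up Uq; apply: le_trans (UC (p, q) _) _ => //=.
by rewrite ler_wpM2r // ler_norm.
Qed.

(** The chain rule gives the derivative u |-> 'd sigma (Lc ('d tau u)), with tau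
the transition from phi to phi' and sigma that from psi' to psi.  By assumption
Lc ('d tau u) represents L u in the chart psi', and 'd sigma brings it back to
the chart psi. *)
Lemma strict_derivative_strict_diff
    (L : {linear tangent M x -> tangent N (f x)}) :
  {for x, continuous f} -> strict_derivative f x L -> strict_diff F a L.
Proof.
move=> fx [phi' [psi' [Lc [[sphi' smphi'] [spsi' smpsi'] LcE strictLc]]]].
have [_ smM] := smphi' _ (chart_at_atlas x).
have [smN smN'] := smpsi' _ (chart_at_atlas (f x)).
have sF' : strict_diff (@local_rep _ _ _ f phi' psi') (cmap phi' x) Lc.
  move=> e e0; have [U [[aU _] Ue]] := strictLc e e0.
  by exists U => // p q Up Uq; exact: (Ue (p, q)).
have := strict_diff_change fx (mem_chart_at x) sphi' (mem_chart_at (f x)) spsi'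
  smM smN sF'.
congr (strict_diff _ _ _); apply/funext => u.
rewrite -[X in Lc X]/(chart_diff phi' u) LcE.
by apply: chart_diffK => //; exact: mem_chart_at.
Qed.

Lemma local_nbhs_shrink (y : M) (c : chart R M) (d : chart R N) U :
  {for y, continuous f} -> csrc c y -> csrc d (f y) -> nbhs (cmap c y) U ->
  exists2 U', U' `<=` U & local_nbhs f d y U'.
Proof.
move=> fy sc sd yU.
have nf : nbhs y (f @^-1` csrc d) by exact: fy _ (near_src sd).
exists (U `&` [set p | [/\ csrc c (cinv c p), csrc d (f (cinv c p)) &
    cmap c (cinv c p) = p]]); first by move=> p [].
split; first by apply: filterI => //; exact: (near_chart sc nf).
by move=> p [_ [scp sdp pE]]; exists (cinv c p).
Qed.

(** The charts at x and f x serve at every nearby point, so that a Lipschitz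
bound around a in coordinates holds around every point of M close to x. *)
Lemma lip_near_lipschitz_on_open K : continuous f -> lip_near K F a ->
  exists2 O : set M, O x & lipschitz_on_open f O.
Proof.
move=> cf [U aU UK].
have lip_x : nbhs x [set y | lipschitz_at f y].
  have n1 : nbhs x (cmap phi @^-1` U°).
    apply: (cmap_cont (mem_chart_at x)).
    by apply: open_nbhs_nbhs; split=> //; exact: open_interior.
  have n2 : nbhs x (f @^-1` csrc psi).
    by apply: cf; apply: near_src; exact: mem_chart_at.
  apply: filterS3 n1 n2 (near_src (mem_chart_at x)) => y Uy sfy sy.
  exists phi, psi, K; split; try exact: chart_at_is_chart.
  move=> e e0; have [U' U'U lU'] := local_nbhs_shrink (cf y) sy sfy Uy.
  exists U'; split=> // -[p q] /= [/U'U Up /U'U Uq].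
  by apply: le_trans (UK _ _ Up Uq) _; rewrite ler_wpM2r // lerDl ltW.
exists ([set y | lipschitz_at f y]°) => //.
by split; [exact: open_interior | exact: interior_subset].
Qed.

Lemma strict_diff_strict_derivative
    (L : {linear tangent M x -> tangent N (f x)}) :
  {for x, continuous f} -> strict_diff F a L -> strict_derivative f x L.
Proof.
move=> fx sF; exists phi, psi, L; split.
- by apply: chart_at_is_chart; exact: mem_chart_at.
- by apply: chart_at_is_chart; exact: mem_chart_at.
- have id_diff (P : smooth_space R) (y : P) (u : tangent P y) :
      chart_diff (chart_at P y) u = u.
    apply: near_id_diff.
    apply: filterS (near_chart (mem_chart_at y) (near_src (mem_chart_at y))).
    by move=> p [].
  by move=> u; rewrite !id_diff.
- move=> e e0; have [U aU Ue] := sF e e0.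
  have [U' U'U lU'] :=
    local_nbhs_shrink fx (mem_chart_at x) (mem_chart_at (f x)) aU.
  by exists U'; split=> // -[p q] /= [/U'U Up /U'U Uq]; exact: Ue.
Qed.

Lemma lip_near_fcone0 K : {for x, continuous f} -> lip_near K F a ->
  fcone0 f x = [set 0].
Proof.
move=> fx lF; rewrite /fcone0 fcone_secant //; apply/seteqP; split=> [w|_ ->].
  move=> [conew [v _ wE]]; move: conew; rewrite -wE => /(graph_cone_lip lF).
  rewrite row_mxKr row_mxKl normr0 mulr0 normr_le0 => /eqP ->.
  by rewrite row_mx0.
split; last by exists 0 => //; rewrite row_mx0.
move=> e /= e0; apply: closure_ball => r r0; exists 0; last exact: ballxx.
exists a, a, 1; split => //; try exact: ballxx.
by rewrite subrr scaler0.
Qed.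

Lemma fcone0_lip_near : {for x, continuous f} -> fcone0 f x = [set 0] ->
  exists2 K, 0 < K & lip_near K F a.
Proof.
move=> fx cone0; apply: cone0_trivial_lip => v conev.
have : fcone0 f x (row_mx 0 v) by split; [rewrite fcone_secant | exists v].
by rewrite cone0 => /(congr1 rsubmx); rewrite row_mxKr linear0.
Qed.

End Manifolds.

Theorem proposition3p3 (R : realType) (M N : manifold R) (f : M -> N)
    (hf : continuous f) (x : M) :
  ((exists2 U : set M, U x & lipschitz_on_open f U) <-> fcone0 f x = [set 0])
  /\
  (strictly_differentiable f x <->
     fcone0 f x = [set 0] /\
     exists W : {vspace tangent (prod_space M N) (x, f x)},
       \dim W = dim_at x /\ fcone f x `<=` [set u | u \in W])
  /\
  (forall L : {linear tangent M x -> tangent N (f x)},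
     strict_derivative f x L -> fcone f x = linear_graph f x L).
Proof.
have fx := hf x.
have graph (L : {linear tangent M x -> tangent N (f x)}) :
    strict_derivative f x L -> fcone f x = linear_graph f x L.
  move=> /(strict_derivative_strict_diff fx) /strict_diff_cone.
  by rewrite fcone_secant.
split; [split|split=> //; split].
- move=> [U Ux [_ /(_ x Ux) lipx]].
  have [K lF] := lipschitz_at_lip_near fx lipx.
  exact: lip_near_fcone0 fx lF.
- move=> /(fcone0_lip_near fx)[K _ lF].
  exact: lip_near_lipschitz_on_open hf lF.
- move=> [L dL]; have sF := strict_derivative_strict_diff fx dL.
  have [K _ lF] := strict_diff_lip sF.
  split; first exact: lip_near_fcone0 fx lF.
  have [W [dimW LW]] := graph_vspace L.
  by exists W; split=> // w; rewrite (graph _ dL) => -[u _ <-]; exact: LW.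
- move=> [/(fcone0_lip_near fx)[K K0 lF] [W [dimW coneW]]].
  rewrite fcone_secant // in coneW.
  have [|L WL] := vspace_graph dimW.
    move=> u; have [v conev] := lip_cone_total u (ltW K0) lF.
    by exists v; exact: coneW.
  exists L; apply: strict_diff_strict_derivative => //.
  by apply: graph_cone_strict lF _ => w /coneW; exact: WL.
Qed.
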